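(* Let $(X,d)$ be a bounded Heine-Borel metric space and let $\mathcal S=(X,(f_i)_{i\in I})$ be a locally finite non-overlapping Infinite Iterated Function System of contractions, where the contractive constant of $f_i$ is $h_i=\mathrm{lip}(f_i)\in(0,1)$. Then there exists a nonempty compact subset $A\subseteq X$ such that $F_{\mathcal S}(A)=A$.
   Context: A metric space is Heine-Borel if each of its closed and bounded subsets is compact. An Infinite Iterated Function System (IIFS) $\mathcal S=(X,(f_i)_{i\in I})$ is a family of selfmaps $f_i:X\to X$ indexed by an arbitrary set $I$; $X$ and $I$ are nonempty. For a map $f$ between metric spaces, $\mathrm{lip}(f)=\sup_{x\neq y}d(f(x),f(y))/d(x,y)$. $\mathcal S$ is an IIFS of contractions if $\bigcup_{i\in I}f_i(B)$ is bounded for every bounded $B\subseteq X$ and $\sup_{i\in I}\mathrm{lip}(f_i)<1$. It is non-overlapping if $f_i(B)\cap f_j(B)=\varnothing$ for all $B\subseteq X$ and all $i\ne j$ in $I$ (equivalently $f_i(X)\cap f_j(X)=\varnothing$ for $i\neq j$). It is locally finite if every $y\in X$ has a neighbourhood $V_y$ such that $\{i\in I: V_y\cap f_i(X)\neq\varnothing\}$ is finite. The operator $F_{\mathcal S}$ on nonempty subsets of $X$ is $F_{\mathcal S}(A):=\bigcup_{i\in I}f_i(A)$. *)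

(* Defs.v *)
From HB Require Import structures.
From mathcomp Require Import all_boot all_order all_algebra.
From mathcomp Require Import all_classical all_reals all_analysis.

Set Implicit Arguments.
Unset Strict Implicit.
Unset Printing Implicit Defensive.

Import Order.TTheory GRing.Theory Num.Theory.

Local Open Scope classical_set_scope.
Local Open Scope ring_scope.

Definition mbounded (R : realType) (X : metricType R) (B : set X) : Prop :=
  exists M : R, forall x y, B x -> B y -> mdist x y <= M.

Definition heine_borel (R : realType) (X : metricType R) : Prop :=
  forall B : set X, closed B -> mbounded B -> compact B.

(* The supremum is taken in the extended reals, so [lip f = +oo] when [f] is
   not Lipschitz; it is [-oo] (supremum of the empty set) when [X] has at most
   one point. *)
Definition lip (R : realType) (X Y : metricType R) (f : X -> Y) : \bar R :=
  ereal_sup [set r | exists x y : X,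
    x <> y /\ r = (mdist (f x) (f y) / mdist x y)%:E].

(* An IIFS is given by its family of maps [f : I -> X -> X]; the nonemptiness
   of [X] and [I] is part of the notion. *)
Definition is_IIFS (X I : Type) (f : I -> X -> X) : Prop :=
  [set: X] !=set0 /\ [set: I] !=set0.

Definition IIFS_op (X I : Type) (f : I -> X -> X) (A : set X) : set X :=
  \bigcup_i f i @` A.

Definition IIFS_contractions (R : realType) (X : metricType R) (I : Type)
    (f : I -> X -> X) : Prop :=
  [/\ is_IIFS f,
      forall B : set X, mbounded B -> mbounded (\bigcup_i f i @` B)
    & (ereal_sup (range (fun i => lip (f i))) < 1%:E)%E].

Definition non_overlapping (X I : Type) (f : I -> X -> X) : Prop :=
  forall (B : set X) (i j : I), i <> j -> f i @` B `&` f j @` B = set0.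

Definition locally_finite (X : topologicalType) (I : Type)
    (f : I -> X -> X) : Prop :=
  forall y : X, exists2 V : set X, nbhs y V &
    finite_set [set i | V `&` range (f i) !=set0].

(* Main.v *)
Require Import Defs.
From HB Require Import structures.
From mathcomp Require Import all_boot all_order all_algebra.
From mathcomp Require Import all_classical all_reals all_analysis.
From mathcomp Require Import lra.

Import Order.TTheory GRing.Theory Num.Theory.

Local Open Scope classical_set_scope.
Local Open Scope ring_scope.

(** A bounded Heine-Borel space is compact, so everything happens in a compact
    metric space.  Among the sets [B] with [B `<=` F B], where [F] is the
    operator of the system, there is a largest one, their union [A].  As [F] is
    monotone, the Knaster-Tarski argument gives [F A = A]
    ([IIFS_op_largest_subinvariant]).

    [A] is nonempty because it contains the fixed points of all the maps
    [f i]; such points exist because the displacement [mdist x (f i x)] attains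
    its minimum on a compact space, and a contraction would decrease a positive
    minimum ([contraction_fixed_point]).

    [A] is closed, hence compact, because its closure is again a competitor.
    This is where local finiteness enters: each [f i @` closure A] is
    compact, hence closed, and the union of a locally finite family of closed
    sets is closed ([closed_bigcup_locally_finite]).  So
    [F (closure A)] is closed, it contains [F A = A], thus it contains
    [closure A], and maximality yields [closure A `<=` A]. *)

Section LargestSubinvariant.
Context {X I : Type} (f : I -> X -> X).

Lemma IIFS_op_subset (A B : set X) :
  A `<=` B -> IIFS_op f A `<=` IIFS_op f B.
Proof. by move=> AB; apply: subset_bigcup => i _; exact: image_subset. Qed.

Definition largest_subinvariant : set X :=
  [set x | exists2 B, B x & B `<=` IIFS_op f B].

Lemma largest_subinvariant_max (B : set X) :
  B `<=` IIFS_op f B -> B `<=` largest_subinvariant.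
Proof. by move=> BFB x Bx; exists B. Qed.

(** Knaster-Tarski: [A `<=` F A] because [F] is monotone and [A] is a union of
    subinvariant sets; then [F A] is subinvariant in turn, and [F A `<=` A] by
    maximality. *)
Lemma IIFS_op_largest_subinvariant :
  IIFS_op f largest_subinvariant = largest_subinvariant.
Proof.
have sub : largest_subinvariant `<=` IIFS_op f largest_subinvariant.
  move=> x [B Bx BFB].
  exact: IIFS_op_subset (largest_subinvariant_max _ BFB) _ (BFB _ Bx).
apply/seteqP; split => //.
by apply: largest_subinvariant_max; exact: IIFS_op_subset.
Qed.

Lemma fixed_point_largest_subinvariant (i : I) (x : X) :
  f i x = x -> largest_subinvariant x.
Proof.
move=> fx; exists [set x] => // _ ->.
by exists i => //; exists x.
Qed.

End LargestSubinvariant.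

(** Near a given point only finitely many members of the family are visible,
    and a finite union of closed sets is closed. *)
Lemma closed_bigcup_locally_finite {X : topologicalType} {I : Type}
    (F : I -> set X) :
  (forall y : X, exists2 V : set X, nbhs y V &
    finite_set [set i | V `&` F i !=set0]) ->
  (forall i, closed (F i)) -> closed (\bigcup_i F i).
Proof.
move=> locfin Fclosed y ycl; have [V yV Vfin] := locfin y.
set J := [set i | _] in Vfin.
(* A finite union indexed by an arbitrary type needs a choice structure on it. *)
have Jclosed : closed (\bigcup_(i in J) F i).
  exact: (@closed_bigcup X {classic I} J F Vfin (fun i _ => Fclosed i)).
suff : (\bigcup_(i in J) F i) y by move=> [i _ Fiy]; exists i.
apply: Jclosed => W yW.
have [z [[i _ Fiz] [Wz Vz]]] := ycl _ (filterI yW yV).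
by exists z; split=> //; exists i => //; exists z.
Qed.

Section Lipschitz.
Context {R : realType} {X : metricType R}.
Implicit Types (f : X -> X) (k : R).

Lemma mdist_lip f k : 0 <= k -> lip f = k%:E ->
  forall x y, mdist (f x) (f y) <= k * mdist x y.
Proof.
move=> k0 fk x y; have [->|xy] := eqVneq x y.
  by rewrite !mdistxx mulr0.
rewrite -ler_pdivrMr ?mdist_gt0// -lee_fin -fk.
by apply: ereal_sup_ubound; exists x, y; split => //; exact/eqP.
Qed.

Lemma lipschitz_continuous f k : 0 < k ->
  (forall x y, mdist (f x) (f y) <= k * mdist x y) -> continuous f.
Proof.
move=> k0 fk x; apply/metricType_numDomainType.cvgrPdist_lt => e e0.
have := nbhsx_ballx x (e / k) (divr_gt0 e0 k0).
apply: filterS => y; rewrite ballEmdist /= => xy.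
by apply: le_lt_trans (fk x y) _; rewrite mulrC -ltr_pdivlMr.
Qed.

Lemma displacement_continuous f :
  (forall x y, mdist (f x) (f y) <= mdist x y) ->
  continuous (fun x => mdist x (f x) : R^o).
Proof.
move=> f1 x; apply/(@cvgrPdist_lt _ R^o) => e e0.
have e20 : 0 < e / 2 by rewrite divr_gt0.
apply: filterS (nbhsx_ballx x _ e20) => y; rewrite ballEmdist /= => xy.
have := f1 x y; have := metric_triangle x y (f x).
have := metric_triangle y (f y) (f x); have := metric_triangle y x (f y).
have := metric_triangle x (f x) (f y).
by rewrite (metric_sym y x) (metric_sym (f y) (f x)) ltr_norml; lra.
Qed.

(** At a minimum [x] of the displacement, [f x] has displacement at most [k]
    times that of [x]; minimality forces the latter to vanish. *)
Lemma contraction_fixed_point f k : [set: X] !=set0 -> compact [set: X] ->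
  k < 1 -> (forall x y, mdist (f x) (f y) <= k * mdist x y) ->
  exists x, f x = x.
Proof.
move=> X0 Xcompact k1 fk.
have f1 x y : mdist (f x) (f y) <= mdist x y.
  by apply: le_trans (fk x y) _; rewrite ler_piMl ?mdist_ge0// ltW.
have [x _ xmin] := compact_EVT_min X0 Xcompact
  (continuous_subspaceT (displacement_continuous f f1)).
exists x; apply/esym/mdist_positivity/eqP; rewrite eq_le mdist_ge0 andbT.
have dle := le_trans (xmin (f x) (mem_set I)) (fk x (f x)).
by rewrite leNgt; apply/negP => d0; nra.
Qed.

End Lipschitz.

Theorem corollary5p2 (R : realType) (X : metricType R) (I : Type)
    (f : I -> X -> X) (h : I -> R)
    (X_bounded : mbounded [set: X])
    (X_heine_borel : heine_borel X)
    (f_contr : IIFS_contractions f)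
    (f_locfin : locally_finite f)
    (f_nonoverlap : non_overlapping f)
    (h_lip : forall i : I, (h i)%:E = lip (f i))
    (h_01 : forall i : I, 0 < h i < 1) :
  exists A : set X, [/\ A !=set0, compact A & IIFS_op f A = A].
Proof.
have [[X0 [i0 _]] _ _] := f_contr.
have Xcompact : compact [set: X] by apply: X_heine_borel => //; exact: closedT.
have f_lip i x y : mdist (f i x) (f i y) <= h i * mdist x y.
  by have /andP[/ltW hi0 _] := h_01 i; exact: mdist_lip.
have f_cont i : continuous (f i).
  by have /andP[hi0 _] := h_01 i; exact: lipschitz_continuous (f_lip i).
have F_closed B : closed B -> closed (IIFS_op f B).
  move=> Bclosed; apply: closed_bigcup_locally_finite => [y|i].
    have [V yV Vfin] := f_locfin y; exists V => //.
    apply: sub_finite_set Vfin => i [z [Vz [x _ fxz]]].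
    by exists z; split => //; exists x.
  apply: compact_closed; first exact: metric_hausdorff.
  apply: continuous_compact; first exact: continuous_subspaceT.
  exact: subclosed_compact Bclosed Xcompact _.
pose A := largest_subinvariant f.
have FA : IIFS_op f A = A := IIFS_op_largest_subinvariant f.
exists A; split => //.
  have /andP[_ hi1] := h_01 i0.
  have [x fx] := contraction_fixed_point (f i0) (h i0) X0 Xcompact hi1 (f_lip i0).
  by exists x; exact: fixed_point_largest_subinvariant fx.
apply: (subclosed_compact _ Xcompact) => //.
suff clA : closure A `<=` A.
  by apply/closure_id/seteqP; split; [exact: subset_closure|].
apply: largest_subinvariant_max.
have /closure_id -> := F_closed _ (@closed_closure _ A).
apply: closure_subset; rewrite -[X in X `<=` _]FA.
by apply: IIFS_op_subset; exact: subset_closure.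
Qed.
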